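(* Let $\alpha=a/b$ with $a\in\mathbb{N}$, $b\in\mathbb{Z}$, $a>|b|\geq 1$ and $\gcd(a,b)=1$. If $a\neq b+1$, then $\alpha\in\mathcal{F}_{|M_\alpha(0)|}$; if $a=b+1$, then $\alpha\in\mathcal{F}_{2|M_\alpha(0)|-1}$. Moreover, a set $S_\alpha$ (a finite set $S\subset\mathbb{C}$ of minimal cardinality with $\mathbb{Z}[\alpha]=S[\alpha]$) can be chosen so that $0\in S_\alpha\subset\mathbb{Z}$.
   Context: For $S\subset\mathbb{C}$ and $\alpha\in\mathbb{C}$, $S[\alpha]:=\{\sum_{j=0}^n f_j\alpha^j : n\in\mathbb{N},\ (f_0,\ldots,f_n)\in S^{n+1}\}$. For an algebraic number $\alpha$, $M_\alpha\in\mathbb{Z}[x]$ is its primitive minimal polynomial over $\mathbb{Q}$ (integer coefficients with gcd $1$). For an algebraic number $\alpha$ for which some finite $S\subset\mathbb{C}$ satisfies $\mathbb{Z}[\alpha]=S[\alpha]$, let $S_\alpha$ denote such a finite set of minimal cardinality; for $N\in\mathbb{N}$, $\mathcal{F}_N$ is the set of algebraic numbers $\alpha$ for which such a set exists and $\operatorname{Card}(S_\alpha)=N$. *)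

(* Defs.v *)
From HB Require Import structures.
From mathcomp Require Import all_boot all_order all_algebra.
From mathcomp Require Import complex.
From mathcomp Require Import all_classical all_reals.
Set Implicit Arguments.
Unset Strict Implicit.
Unset Printing Implicit Defensive.
Import Order.TTheory GRing.Theory Num.Theory.
Local Open Scope classical_set_scope.
Local Open Scope card_scope.
Local Open Scope ring_scope.

Definition intset (R : realType) : set R[i] := range (intr : int -> R[i]).

(* S[alpha], with n ranging over the natural numbers including 0, so that
   S is a subset of S[alpha]. *)
Definition adjoin (R : realType) (S : set R[i]) (alpha : R[i]) : set R[i] :=
  [set x | exists n : nat, exists f : 'I_n.+1 -> R[i],
     (forall j, S (f j)) /\ x = \sum_(j < n.+1) f j * alpha ^+ j].

Definition digit_set (R : realType) (alpha : R[i]) (S : set R[i]) : Prop :=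
  finite_set S /\ adjoin (@intset R) alpha = adjoin S alpha.

Definition min_digit_set (R : realType) (alpha : R[i]) (S : set R[i]) : Prop :=
  digit_set alpha S /\ forall T : set R[i], digit_set alpha T -> S #<= T.

(* [zcontents M = 1] says that the gcd of the coefficients is 1 and that the
   leading coefficient is positive; the latter only fixes the sign of M. *)
Definition is_prim_minpoly (R : realType) (alpha : R[i]) (M : {poly int}) :
  Prop :=
  [/\ zcontents M = 1,
      root (map_poly (intr : int -> R[i]) M) alpha
    & forall q : {poly rat}, q != 0 ->
        root (map_poly (ratr : rat -> R[i]) q) alpha ->
        (size M <= size q)%N].

(* The default value 0 is taken exactly when alpha is transcendental. *)
Definition prim_minpoly (R : realType) (alpha : R[i]) : {poly int} :=
  xget 0 [set M | is_prim_minpoly alpha M].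

Definition calF (R : realType) (N : nat) : set R[i] :=
  [set alpha | algebraicOver (ratr : rat -> R[i]) alpha /\
     exists S : set R[i], min_digit_set alpha S /\ S #= `I_N].

(* Main.v *)
Require Import Defs.
From HB Require Import structures.
From mathcomp Require Import all_boot all_order all_algebra.
From mathcomp Require Import complex.
From mathcomp Require Import all_classical all_reals.
From mathcomp Require Import zify ring.
Set Implicit Arguments.
Unset Strict Implicit.
Unset Printing Implicit Defensive.
Import Order.TTheory GRing.Theory Num.Theory.
Local Open Scope classical_set_scope.
Local Open Scope ring_scope.
Local Open Scope card_scope.

(** Every element of [Z[alpha]] is congruent modulo [alpha Z[alpha]] to a digit,
    and for [alpha = a/b] integers congruent modulo [alpha] are congruent modulo
    [a], so a digit set meets the [a] disjoint classes of [0, .., a - 1].  If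
    [a = b + 1] and [t] is the only digit in its class, then
    [- b t = t + alpha (- b t)] forces every expansion of [- b t] to consist of
    digits [t] only, whence [- b t = t] and [t = 0]: each of the [a - 1] nonzero
    classes needs two digits.

    Conversely, let the digits be integers forming a complete residue system
    modulo [a].  Stripping digits reduces an expansion to elements [b q] with
    [q] an integer, and [b q = d + alpha (b q')] as soon as [b q = d + a q'].
    So it suffices to choose the digits such that [q |-> q'] always leads to
    [0].  This holds for [{0, .., a - 1}] if [b < 0], for [{- b, .., b}] if
    [a = b + 1], and otherwise, with [c = a - b >= 2], for the set obtained from
    [{0, .., a - 1}] by replacing each nonzero multiple [r] of [c], which would
    create a nonzero fixed point of [q |-> q'], by [r - a]. *)

Local Notation int_adjoin alpha := (adjoin (@intset _) alpha).

Lemma card_le_setU (T : Type) (U : choiceType) (A B : set T) (C D : set U) :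
  [disjoint A & B] -> [disjoint C & D] -> A #<= C -> B #<= D ->
  A `|` B #<= C `|` D.
Proof.
move=> AB; rewrite -disj_set_some => CD.
rewrite -[A #<= C]card_le_some -[B #<= D]card_le_some.
rewrite -[_ #<= C `|` D]card_le_some image_setU.
move=> /pcard_leP/unsquash f /pcard_leP/unsquash g.
exact: (inj_card_le (glue AB CD f g)).
Qed.

Lemma card_le_II_setU (U : choiceType) (m n : nat) (A B : set U) :
  [disjoint A & B] -> `I_m #<= A -> `I_n #<= B -> `I_(m + n) #<= A `|` B.
Proof.
move=> AB mA nB; have sub_mn : `I_m `<=` `I_(m + n).
  by move=> i /= im; rewrite ltn_addr.
rewrite -(setDUK sub_mn); apply: card_le_setU => //.
  by apply/disj_set2P; exact: setDIK.
by rewrite (card_le_eql card_IID) addKn.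
Qed.

Lemma card_le_bigcup_sum (U : choiceType) (F : nat -> set U) (k : nat -> nat)
    (n : nat) :
  trivIset `I_n F -> (forall i, (i < n)%N -> `I_(k i) #<= F i) ->
  `I_(\sum_(i < n) k i) #<= \bigcup_(i < n) F i.
Proof.
elim: n => [|n IHn] Ftriv kF; first by rewrite big_ord0 II0.
rewrite big_ord_recr IIS bigcup_setU bigcup_set1 /=.
apply: card_le_II_setU; last exact: kF.
- apply/disj_set2P; rewrite -subset0 => x [[i /= ni Fi] Fn].
  have eq_in : i = n by apply: Ftriv; [exact: ltnW|exact: ltnSn|exists x].
  by rewrite eq_in ltnn in ni.
- apply: IHn => [|i ni]; last by apply: kF; exact: ltnW.
  by apply: sub_trivIset Ftriv => i /= /ltnW.
Qed.

Lemma card_ge1 (T : Type) (A : set T) : A !=set0 -> `I_1 #<= A.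
Proof.
move=> [x Ax]; rewrite -(card_le_eql (@card_set1 _ x)).
by apply: subset_card_le => _ ->.
Qed.

Lemma card_ge2 (T : choiceType) (A : set T) : ~ is_subset1 A -> `I_2 #<= A.
Proof.
apply: contra_notP => A_lt2 x y Ax Ay; apply: contrapT => /eqP xy; apply: A_lt2.
rewrite -(setDUK (_ : [set x] `<=` A)); last by move=> _ ->.
apply: (@card_le_II_setU _ 1 1); first by apply/disj_set2P; rewrite setDIK.
  by apply: card_ge1; exists x.
by apply: card_ge1; exists y; split => //; apply/eqP; rewrite eq_sym.
Qed.

Section Adjoin.
Variables (R : realType) (S : set R[i]) (alpha : R[i]).

Lemma adjoin_digit (x : R[i]) : S x -> adjoin S alpha x.
Proof.
move=> Sx; exists 0%N, (fun=> x); split => //.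
by rewrite big_ord1 expr0 mulr1.
Qed.

Lemma adjoin_cons (d x : R[i]) :
  S d -> adjoin S alpha x -> adjoin S alpha (d + alpha * x).
Proof.
move=> Sd [n [f [Sf ->]]].
exists n.+1, (fun j => oapp f d (unlift ord0 j)); split.
  by move=> j; case: unliftP => [k|] _ /=.
rewrite [RHS]big_ord_recl unlift_none expr0 mulr1 mulr_sumr; congr (_ + _).
by apply: eq_bigr => j _; rewrite liftK lift0 exprS mulrCA.
Qed.

Lemma adjoin_ind (P : R[i] -> Prop) :
  (forall d, S d -> P d) ->
  (forall d x, S d -> adjoin S alpha x -> P x -> P (d + alpha * x)) ->
  forall x, adjoin S alpha x -> P x.
Proof.
move=> Pdigit Pcons x [n [f [Sf ->]]].
elim: n f Sf => [|n IHn] f Sf.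
  by rewrite big_ord1 expr0 mulr1; exact: Pdigit.
rewrite big_ord_recl expr0 mulr1.
under eq_bigr => j _ do rewrite lift0 exprS mulrCA.
rewrite -mulr_sumr; apply: Pcons => //; last exact: IHn.
by exists n, (fun j => f (lift ord0 j)).
Qed.

End Adjoin.

Section IntAdjoin.
Variables (R : realType) (alpha : R[i]).
Implicit Types (x y z : R[i]) (T : set R[i]).

Lemma int_adjoinP x :
  int_adjoin alpha x <-> exists p : {poly int}, x = (map_poly intr p).[alpha].
Proof.
split=> [|[p ->]].
  elim/adjoin_ind => [_ [m _ <-]|_ _ [m _ <-] _ [p ->]].
    by exists m%:P; rewrite map_polyC hornerC.
  exists (m%:P + 'X * p).
  by rewrite rmorphD rmorphM /= map_polyC map_polyX !hornerE.
exists (size p), (fun j => (p`_j)%:~R); split=> [j|]; first by exists p`_j.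
have sizep : (size (map_poly (intr : int -> R[i]) p) <= (size p).+1)%N.
  exact: leq_trans (size_poly _ _) _.
by rewrite (horner_coef_wide _ sizep); apply: eq_bigr => j _; rewrite coef_map.
Qed.

Lemma int_adjoin_intr (m : int) : int_adjoin alpha m%:~R.
Proof. by apply: adjoin_digit; exists m. Qed.

Lemma int_adjoinB x y :
  int_adjoin alpha x -> int_adjoin alpha y -> int_adjoin alpha (x - y).
Proof.
move=> /int_adjoinP[p ->] /int_adjoinP[q ->]; apply/int_adjoinP; exists (p - q).
by rewrite rmorphB hornerD hornerN.
Qed.

Lemma int_adjoinM x y :
  int_adjoin alpha x -> int_adjoin alpha y -> int_adjoin alpha (x * y).
Proof.
move=> /int_adjoinP[p ->] /int_adjoinP[q ->]; apply/int_adjoinP; exists (p * q).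
by rewrite rmorphM hornerM.
Qed.

Definition congr_mod x y : Prop :=
  exists2 z, int_adjoin alpha z & x - y = alpha * z.

Lemma congr_mod_refl x : congr_mod x x.
Proof. by exists 0; [exact: (int_adjoin_intr 0)|rewrite subrr mulr0]. Qed.

Lemma congr_mod_euclid x y z :
  congr_mod x z -> congr_mod y z -> congr_mod x y.
Proof.
move=> [u Au xz] [v Av yz]; exists (u - v); first exact: int_adjoinB.
by rewrite mulrBr -xz -yz opprB addrA subrK.
Qed.

Lemma congr_mod_sym x y : congr_mod x y -> congr_mod y x.
Proof. exact/congr_mod_euclid/congr_mod_refl. Qed.

Lemma congr_mod_trans x y z : congr_mod x y -> congr_mod y z -> congr_mod x z.
Proof. by move=> xy /congr_mod_sym; exact: congr_mod_euclid. Qed.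

Lemma congr_mod_cons d x : int_adjoin alpha x -> congr_mod (d + alpha * x) d.
Proof. by move=> Ax; exists x; rewrite // addrC addKr. Qed.

Definition digit_class T x : set R[i] := T `&` congr_mod x.

Lemma digit_set_sub T : digit_set alpha T -> T `<=` int_adjoin alpha.
Proof. by case=> _ -> t; exact: adjoin_digit. Qed.

Lemma digit_class_nonempty T x :
  digit_set alpha T -> int_adjoin alpha x -> digit_class T x !=set0.
Proof.
move=> [_ AT]; rewrite {1}AT; elim/adjoin_ind => [d Td|d y Td Ty _].
  by exists d; split => //; exact: congr_mod_refl.
by exists d; split => //; apply: congr_mod_cons; rewrite AT.
Qed.

Lemma lone_digit_fixpoint T t x :
  alpha != 0 -> digit_set alpha T -> int_adjoin alpha x -> T t ->
  x = t + alpha * x -> is_subset1 (digit_class T x) -> t = 0.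
Proof.
move=> alpha0 [_ AT] Ax Tt xE class1.
have xt : digit_class T x t by split=> //; rewrite xE; exact: congr_mod_cons.
suff expansion y : adjoin T alpha y -> y = x -> t = 0.
  by apply: (expansion x); rewrite -?AT.
elim/adjoin_ind: y / => [d Td dx|d y Td Ty IHy dyx].
  have tx : t = x.
    by apply: class1; rewrite // -dx; split=> //; exact: congr_mod_refl.
  have /eqP : alpha * x = 0 by apply: (addrI t); rewrite addr0 -xE.
  by rewrite mulf_eq0 (negbTE alpha0) -tx => /eqP.
have dt : d = t.
  apply: class1 => //; split=> //; rewrite -dyx.
  by apply: congr_mod_cons; rewrite AT.
by apply: IHy; apply: (mulfI alpha0); apply: (addrI t); rewrite -xE -dt.
Qed.

End IntAdjoin.

Section FractionLowerBound.
Variables (R : realType) (alpha : R[i]) (a b : int).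
Hypotheses (alpha_b : alpha * b%:~R = a%:~R) (cab : coprimez a b).
Implicit Types (T : set R[i]) (p q r : int) (i n : nat).

Lemma int_adjoin_denom (x : R[i]) :
  int_adjoin alpha x -> exists n p, x * b%:~R ^+ n = p%:~R.
Proof.
elim/adjoin_ind => [_ [p _ <-]|_ y [p _ <-] _ [n [q yq]]].
  by exists 0%N, p; rewrite mulr1.
exists n.+1, (p * b ^+ n.+1 + a * q).
rewrite rmorphD !rmorphM rmorphXn /= -yq -alpha_b exprS; ring.
Qed.

Lemma congr_mod_int p q : congr_mod alpha p%:~R q%:~R -> (a %| p - q)%Z.
Proof.
move=> [z /int_adjoin_denom[n [m zm]] pqz].
rewrite -(Gauss_dvdzl _ (coprimezXr n.+1 cab)); apply/dvdzP; exists m.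
apply: (@intr_inj R[i]).
rewrite !rmorphM rmorphB rmorphXn /= pqz -zm -alpha_b exprS; ring.
Qed.

Lemma trivIset_digit_class T :
  trivIset `I_(absz a) (fun i => digit_class alpha T i%:R).
Proof.
move=> i j /= ia ja [t [[_ it] [_ jt]]]; rewrite !pmulrn in it jt.
have /dvdzP[m ijE] := congr_mod_int (congr_mod_euclid it jt).
have [m0|m0] := eqVneq m 0; first by rewrite m0 in ijE; lia.
by nia.
Qed.

Lemma digit_set_card_sum T (k : nat -> nat) :
  (forall i, (i < absz a)%N -> `I_(k i) #<= digit_class alpha T i%:R) ->
  `I_(\sum_(i < absz a) k i) #<= T.
Proof.
move=> kT.
apply: card_le_trans (card_le_bigcup_sum (@trivIset_digit_class T) kT) _.
by apply: subset_card_le; apply: bigcup_sub => i _; exact: subIsetl.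
Qed.

Lemma digit_set_card_ge T : digit_set alpha T -> `I_(absz a) #<= T.
Proof.
move=> dT; have := @digit_set_card_sum T (fun=> 1%N).
rewrite sum1_card card_ord; apply => i _; apply: card_ge1.
by apply: digit_class_nonempty => //; rewrite pmulrn; exact: int_adjoin_intr.
Qed.

Lemma digit_class_nontrivial T r :
  a = b + 1 -> a != 0 -> digit_set alpha T -> ~~ (a %| r)%Z ->
  ~ is_subset1 (digit_class alpha T r%:~R).
Proof.
move=> ab a0 dT /negP ar class1; apply: ar.
have alpha0 : alpha != 0.
  apply: contraNneq a0 => alpha0.
  by rewrite -(@intr_eq0 R[i]) -alpha_b alpha0 mul0r.
have [t [Tt rt]] := digit_class_nonempty dT (int_adjoin_intr alpha r).
have At := digit_set_sub dT Tt.
have Ax : int_adjoin alpha (- b%:~R * t).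
  by rewrite -rmorphN; apply: int_adjoinM => //; exact: int_adjoin_intr.
have xE : - b%:~R * t = t + alpha * (- b%:~R * t).
  by rewrite mulrA mulrN alpha_b ab rmorphD; ring.
have t0 : t = 0.
  apply: (lone_digit_fixpoint alpha0 dT Ax Tt xE) => s u [Ts xs] [Tu xu].
  have rx : congr_mod alpha r%:~R (- b%:~R * t).
    by apply: congr_mod_euclid rt _; rewrite xE; exact: congr_mod_cons.
  by apply: class1; split=> //; exact: congr_mod_trans rx _.
by rewrite -[r]subr0; apply: congr_mod_int; rewrite mulr0z -t0.
Qed.

Lemma digit_set_card_ge_succ T :
  a = b + 1 -> a != 0 -> digit_set alpha T -> `I_(2 * absz a - 1) #<= T.
Proof.
move=> ab a0 dT.
have -> : (2 * absz a - 1 = \sum_(i < absz a) (i != 0 :> nat).+1)%N.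
  case: (absz a) (absz_gt0 a) => [|n _]; first by rewrite a0.
  by rewrite big_ord_recl /= sum_nat_const card_ord; lia.
apply: (@digit_set_card_sum T (fun i => (i != 0%N).+1)) => i ia.
rewrite pmulrn; have [i0|i0] := eqVneq i 0%N.
  by apply/card_ge1/digit_class_nonempty => //; exact: int_adjoin_intr.
apply/card_ge2/digit_class_nontrivial => //.
by rewrite dvdzE gtnNdvd // lt0n.
Qed.

End FractionLowerBound.

Section IntegerDigits.
Implicit Types (a b c m n p q r : int) (D : set int).

Definition complete_residues a D : Prop :=
  forall p, exists2 d, D d & (a %| p - d)%Z.

Definition digit_descent a b D (weight : int -> nat) : Prop :=
  forall q, q != 0 -> exists d q',
    [/\ D d, b * q = d + a * q' & (weight q' < weight q)%N].

Lemma card_int_itv m n : m <= n -> `[m, n[%classic #= `I_(absz (n - m)).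
Proof.
move=> mn.
have -> : `[m, n[%classic = (fun i : nat => m + i%:Z) @` `I_(absz (n - m)).
  apply/seteqP; split=> [p|_ [i /= im <-]]; rewrite /= in_itv /=; last by lia.
  by move=> pmn; exists (absz (p - m)); lia.
by apply: inj_card_eq => i j _ _; lia.
Qed.

Lemma complete_residues_itv a m n :
  0 < a -> a <= n - m -> complete_residues a `[m, n[%classic.
Proof.
move=> a0 amn p; exists (m + ((p - m) %% a)%Z).
  by rewrite /= in_itv /=; lia.
by apply/dvdzP; exists ((p - m) %/ a)%Z; lia.
Qed.

Lemma complete_residues_image a D (f : int -> int) :
  (forall d, (a %| d - f d)%Z) -> complete_residues a D ->
  complete_residues a (f @` D).
Proof.
move=> af Dfull p; have [d Dd apd] := Dfull p; exists (f d); first by exists d.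
by rewrite -(subrKA d) rpredD.
Qed.

(* The sign term breaks the tie when the quotient of [q > 0] is [- q]. *)
Lemma digit_descent_neg a b : b < 0 -> - a < b ->
  digit_descent a b `[0, a[%classic (fun q => (absz q).*2 + (0 < q)%R)%N.
Proof.
move=> b0 ba q q0; exists (b * q %% a)%Z, (b * q %/ a)%Z.
have qE := divz_eq (b * q) a.
have r_itv : 0 <= (b * q %% a)%Z < a by lia.
split; [by rewrite /= in_itv|lia|].
move: (b * q %% a)%Z (b * q %/ a)%Z => r u in r_itv qE *.
have [qpos|qneg] : 0 < q \/ q < 0 by lia.
  have uq : - q <= u < 0 by nia.
  by lia.
have uq : 0 <= u < - q by nia.
by lia.
Qed.

Lemma digit_descent_succ a b :
  0 < b -> a = b + 1 -> digit_descent a b `[- b, a[%classic absz.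
Proof.
move=> b0 ab q q0.
suff [r [u [rb qE uq]]] : exists r u,
    [/\ `|r| <= b, b * q = r + a * u & `|u| < `|q|].
  by exists r, u; split=> //; rewrite /= ?in_itv /=; lia.
wlog qpos : q q0 / 0 < q => [pos|].
  have [qpos|qneg] : 0 < q \/ 0 < - q by lia.
    exact: pos.
  have [r [u [rb qE uq]]] := pos (- q) ltac:(lia) qneg.
  by exists (- r), (- u); split; lia.
exists (b * q %% a)%Z, (b * q %/ a)%Z.
have qE := divz_eq (b * q) a.
have r_itv : 0 <= (b * q %% a)%Z < a by lia.
split; [lia|lia|nia].
Qed.

Definition shift_multiples a c r : int :=
  if (r != 0) && (c %| r)%Z then r - a else r.

Lemma dvdz_sub_shift_multiples a c r : (a %| r - shift_multiples a c r)%Z.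
Proof.
rewrite /shift_multiples; case: ifP => _; last by rewrite subrr dvdz0.
by rewrite opprB addrC subrK.
Qed.

Lemma card_shift_multiples a c :
  0 <= a -> shift_multiples a c @` `[0, a[%classic #= `I_(absz a).
Proof.
move=> a0; rewrite -[absz a](congr1 absz (subr0 a)).
apply: (card_eq_trans _ (card_int_itv a0)); apply: inj_card_eq => r s.
rewrite !inE /= !in_itv /= /shift_multiples.
by case: ifP => _; case: ifP => _; lia.
Qed.

Lemma coprimez_dvdz_sub a b :
  coprimez a b -> (a - b %| a)%Z -> absz (a - b) = 1%N.
Proof.
move=> /eqP cab ca; have : (a - b %| gcdz a b)%Z.
  by rewrite dvdz_gcd ca -[X in (_ %| X)%Z](subKr a b); exact: rpredB.
by rewrite cab dvdz1 => /eqP.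
Qed.

(* A nonzero [q] is its own quotient [b q %/ a] iff [q < 0] and the remainder is
   [- (a - b) q].  Shifting a remainder [r] adds [1] to the quotient, and this
   fixes a [q > 0] only if [r = a - (a - b) q], so that [a - b] divides [a]. *)
Lemma digit_descent_pos a b : 0 < b -> b + 1 < a -> coprimez a b ->
  digit_descent a b (shift_multiples a (a - b) @` `[0, a[%classic) absz.
Proof.
move=> b0 ba cab q q0.
have qE := divz_eq (b * q) a.
have r_itv : 0 <= (b * q %% a)%Z < a by lia.
move: (b * q %% a)%Z (b * q %/ a)%Z => r u in r_itv qE *.
suff [q' [qE' qq']] : exists q',
    b * q = shift_multiples a (a - b) r + a * q' /\ (absz q' < absz q)%N.
  by exists (shift_multiples a (a - b) r), q'; split => //; exists r.
rewrite /shift_multiples; have [qpos|qneg] : 0 < q \/ q < 0 by lia.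
- have uq : 0 <= u < q by nia.
  case: ifP => [/andP[r0 cr]|_]; last by exists u; lia.
  exists (u + 1); split; first by lia.
  suff : u + 1 != q by lia.
  apply/eqP => uq1.
  have : (a - b %| a)%Z.
    have aE : a = r + q * (a - b) by nia.
    by rewrite [X in (_ %| X)%Z]aE; apply: rpredD => //; exact: dvdz_mull.
  by move=> /(coprimez_dvdz_sub cab); lia.
have uq : q <= u < 0 by nia.
case: ifPn => [_|]; first by exists (u + 1); lia.
move=> rc; exists u; split; first by lia.
suff : u != q by lia.
apply: contraNneq rc => uqE; apply/andP; split; first by nia.
by apply/dvdzP; exists (- q); nia.
Qed.

End IntegerDigits.

Section FractionUpperBound.
Variables (R : realType) (alpha : R[i]) (a b : int).
Hypothesis alpha_b : alpha * b%:~R = a%:~R.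

Lemma adjoin_division_step (S : set R[i]) (d p q : int) (x : R[i]) :
  S d%:~R -> p = d + a * q -> adjoin S alpha (b%:~R * q%:~R + x) ->
  adjoin S alpha (p%:~R + alpha * x).
Proof.
move=> Sd -> Ax; have := adjoin_cons Sd Ax.
by rewrite mulrDr mulrA alpha_b rmorphD rmorphM addrA.
Qed.

Lemma adjoin_descent (D : set int) (weight : int -> nat) :
  D 0 -> digit_descent a b D weight ->
  forall q, adjoin (intr @` D) alpha (b%:~R * q%:~R).
Proof.
move=> D0 descent q; have [n] := ubnP (weight q); elim: n q => // n IHn q qn.
have [->|q0] := eqVneq q 0.
  by rewrite mulr0; apply: adjoin_digit; exists 0.
have [d [q' [Dd qE q'q]]] := descent q q0.
have := @adjoin_division_step _ d _ q' 0 _ qE.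
rewrite mulr0 !addr0 rmorphM; apply; first by exists d.
by apply: IHn; exact: leq_trans q'q _.
Qed.

Lemma int_adjoin_sub_adjoin (D : set int) (weight : int -> nat) :
  D 0 -> complete_residues a D -> digit_descent a b D weight ->
  int_adjoin alpha `<=` adjoin (intr @` D) alpha.
Proof.
move=> D0 Dfull descent x Ax.
suff : forall q, adjoin (intr @` D) alpha (b%:~R * q%:~R + x).
  by move=> /(_ 0); rewrite mulr0 add0r.
elim/adjoin_ind: x / Ax => [_ [p _ <-] q|_ x [p _ <-] _ IHx q].
  have [d Dd /dvdzP[m pm]] := Dfull (b * q + p).
  have pE : b * q + p = d + a * m by lia.
  have := @adjoin_division_step _ d _ m 0 _ pE.
  rewrite mulr0 !addr0 rmorphD rmorphM; apply; first by exists d.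
  exact: (adjoin_descent D0 descent).
have [d Dd /dvdzP[m pm]] := Dfull (b * q + p).
rewrite addrA -rmorphM -rmorphD.
by apply: (@adjoin_division_step _ d _ m); [by exists d|lia|exact: IHx].
Qed.

Lemma digit_set_descent (D : set int) (weight : int -> nat) :
  finite_set D -> D 0 -> complete_residues a D -> digit_descent a b D weight ->
  digit_set alpha (intr @` D : set R[i]).
Proof.
move=> Dfin D0 Dfull descent; split; first exact: finite_image.
apply/seteqP; split; first exact: (int_adjoin_sub_adjoin D0 Dfull descent).
move=> x; elim/adjoin_ind: x / => [_ [d _ <-]|_ x [d _ <-] _ Ax].
  exact: int_adjoin_intr.
by apply: adjoin_cons => //; exists d.
Qed.

End FractionUpperBound.

Section PrimitiveMinimalPolynomial.
Variables (R : realType) (alpha : R[i]).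
Local Notation complex_poly := (map_poly (intr : int -> R[i])).
Implicit Types (M p : {poly int}).

Lemma is_prim_minpoly_neq0 M : is_prim_minpoly alpha M -> M != 0.
Proof. by case=> cM _ _; apply: contra_eq_neq cM => ->; rewrite zcontents0. Qed.

Lemma is_prim_minpoly_size_le M p :
  is_prim_minpoly alpha M -> p != 0 -> root (complex_poly p) alpha ->
  (size M <= size p)%N.
Proof.
move=> [_ _ minM] p0 rootp.
rewrite -(size_map_inj_poly (@intr_inj rat) erefl p).
apply: minM; first by rewrite map_poly_eq0_id0 // intr_eq0 lead_coef_eq0.
rewrite -map_poly_comp (eq_map_poly (g := intr)) // => m /=.
exact: ratr_int.
Qed.

Lemma is_prim_minpoly_proportional M p :
  is_prim_minpoly alpha M -> root (complex_poly p) alpha -> size p = size M ->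
  lead_coef p *: M = lead_coef M *: p.
Proof.
move=> primM rootp sizep; have M0 := is_prim_minpoly_neq0 primM.
pose d := lead_coef p *: M - lead_coef M *: p.
have rootD : root (complex_poly d) alpha.
  case: primM => _ rootM _; rewrite /root rmorphB /= !map_polyZ !hornerE.
  by rewrite (rootP rootM) (rootP rootp) !mulr0 subrr.
have ltdM : (size d < size M)%N.
  rewrite -(prednK (_ : 0 < size M)%N) ?size_poly_gt0 // ltnS.
  apply/leq_sizeP => i; rewrite leq_eqVlt => /orP[/eqP <-|Mi].
    by rewrite coefB !coefZ -{2}sizep -!/(lead_coef _) mulrC subrr.
  rewrite prednK ?size_poly_gt0 // in Mi.
  by rewrite coefB !coefZ !nth_default ?mulr0 ?subrr // sizep.
apply/eqP; rewrite -subr_eq0; apply: contraTT ltdM => d0.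
by rewrite -leqNgt is_prim_minpoly_size_le.
Qed.

Lemma is_prim_minpoly_uniq : is_subset1 [set M | is_prim_minpoly alpha M].
Proof.
move=> M M' primM primM'; have [[cM rootM _] [cM' rootM' _]] := (primM, primM').
have sizeM : size M' = size M.
  by apply/eqP; rewrite eqn_leq !is_prim_minpoly_size_le ?is_prim_minpoly_neq0.
have leadM := is_prim_minpoly_proportional primM rootM' sizeM.
rewrite (zpolyEprim M) (zpolyEprim M') cM cM' !scale1r.
move/(congr1 zprimitive): leadM.
by rewrite !zprimitiveZ ?lead_coef_eq0 ?is_prim_minpoly_neq0.
Qed.

Lemma prim_minpoly_eq M : is_prim_minpoly alpha M -> prim_minpoly alpha = M.
Proof. by move=> primM; exact: (xget_subset1 0 primM is_prim_minpoly_uniq). Qed.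

End PrimitiveMinimalPolynomial.

Lemma is_prim_minpoly_ratr (R : realType) (r : rat) :
  is_prim_minpoly (ratr r : R[i]) (denq r *: 'X - (numq r)%:P).
Proof.
have size_linear : size (denq r *: 'X - (numq r)%:P) = 2%N.
  rewrite size_polyDl size_scale ?size_polyX ?denq_neq0 // size_polyN.
  exact: leq_ltn_trans (size_polyC_leq1 _) _.
split.
- rewrite /zcontents /lead_coef size_linear !big_ord_recl big_ord0 !coefE /=.
  rewrite mulr0 mulr1 sub0r subr0 gcdn0 abszN.
  by rewrite (eqP (coprime_num_den r)) gtr0_sgz ?denq_gt0.
- rewrite rootE rmorphB /= map_polyZ map_polyX map_polyC !hornerE /=.
  by rewrite /ratr mulrAC divff ?mul1r ?subrr // intr_eq0 denq_neq0.
- move=> q q0 rootq; rewrite size_linear.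
  rewrite -(size_map_poly (ratr : {rmorphism rat -> R[i]})).
  by apply: root_size_gt1 rootq; rewrite map_poly_eq0.
Qed.

Lemma absz_numq_frac (a b : int) :
  coprimez a b -> b != 0 -> absz (numq (a%:Q / b%:Q)) = absz a.
Proof. by move=> cab b0; rewrite coprimeq_num // abszM absz_sg b0 mul1n. Qed.

Definition min_int_digits (R : realType) (alpha : R[i]) (N : nat) : Prop :=
  exists S : set R[i],
    [/\ min_digit_set alpha S, S #= `I_N, S 0 & S `<=` @intset R].

Lemma calF_min_int_digits (R : realType) (alpha : R[i]) (N : nat) :
  algebraicOver (ratr : rat -> R[i]) alpha -> min_int_digits alpha N ->
  calF N alpha.
Proof. by move=> alg [S [minS SN _ _]]; split=> //; exists S. Qed.

Section MinimalIntegerDigits.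
Variables (R : realType) (alpha : R[i]) (a b : int).
Hypotheses (alpha_b : alpha * b%:~R = a%:~R) (cab : coprimez a b) (a0 : 0 < a).

Lemma min_int_digits_descent (D : set int) (weight : int -> nat) (N : nat) :
  D #= `I_N -> D 0 -> complete_residues a D -> digit_descent a b D weight ->
  (forall T : set R[i], digit_set alpha T -> `I_N #<= T) ->
  min_int_digits alpha N.
Proof.
move=> DN D0 Dfull descent minN; pose S : set R[i] := intr @` D.
have SN : S #= `I_N.
  by apply: card_eq_trans DN; apply: inj_card_eq => p q _ _; exact: intr_inj.
exists S; split=> //; [split|by exists 0|by move=> _ [d _ <-]; exists d].
  apply: (digit_set_descent alpha_b _ D0 Dfull descent).
  by apply/finite_setP; exists N.
by move=> T /minN; rewrite (card_le_eql SN).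
Qed.

Lemma min_int_digits_neg : b < 0 -> - a < b -> min_int_digits alpha (absz a).
Proof.
move=> b0 ba; apply: (min_int_digits_descent (D := `[0, a[%classic)).
- by have := card_int_itv (ltW a0); rewrite subr0.
- by rewrite /= in_itv /=; lia.
- by apply: complete_residues_itv; rewrite ?subr0.
- exact: digit_descent_neg.
- by move=> T; exact: (digit_set_card_ge alpha_b cab).
Qed.

Lemma min_int_digits_succ :
  0 < b -> a = b + 1 -> min_int_digits alpha (2 * absz a - 1).
Proof.
move=> b0 ab; apply: (min_int_digits_descent (D := `[- b, a[%classic)).
- have -> : (2 * absz a - 1)%N = absz (a - - b) by lia.
  by apply: card_int_itv; lia.
- by rewrite /= in_itv /=; lia.
- by apply: complete_residues_itv => //; lia.
- exact: digit_descent_succ.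
- by move=> T; apply: (digit_set_card_ge_succ alpha_b cab ab); lia.
Qed.

Lemma min_int_digits_pos : 0 < b -> b + 1 < a -> min_int_digits alpha (absz a).
Proof.
move=> b0 ba.
pose D := shift_multiples a (a - b) @` `[0, a[%classic.
apply: (min_int_digits_descent (D := D)).
- by apply: card_shift_multiples; exact: ltW.
- by exists 0; [rewrite /= in_itv /=; lia|rewrite /shift_multiples eqxx].
- apply: complete_residues_image; first exact: dvdz_sub_shift_multiples.
  by apply: complete_residues_itv; rewrite ?subr0.
- exact: digit_descent_pos.
- by move=> T; exact: (digit_set_card_ge alpha_b cab).
Qed.

End MinimalIntegerDigits.

Theorem theorem2 (R : realType) (a : nat) (b : int) (alpha : R[i])
    (hb : (1 <= absz b)%N) (hab : (absz b < a)%N) (hcop : coprime a (absz b))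
    (halpha : alpha = a%:R / b%:~R) :
  [/\ a%:Z <> b + 1 -> calF (absz (prim_minpoly alpha).[0]) alpha,
      a%:Z = b + 1 -> calF (2 * absz (prim_minpoly alpha).[0] - 1)%N alpha
    & exists S : set R[i],
        [/\ min_digit_set alpha S, S 0 & S `<=` @intset R]].
Proof.
have b0 : b != 0 by lia.
have a0 : 0 < a%:Z by lia.
have cab : coprimez a b by rewrite coprimezE.
have alpha_b : alpha * b%:~R = a%:Z%:~R.
  by rewrite halpha divfK ?intr_eq0 // pmulrn.
have alphaE : alpha = ratr (a%:Z%:Q / b%:Q).
  by rewrite fmorph_div /= !ratr_int halpha pmulrn.
have -> : absz (prim_minpoly alpha).[0] = a.
  rewrite alphaE (prim_minpoly_eq (is_prim_minpoly_ratr R _)) !hornerE abszN.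
  exact: absz_numq_frac.
have alg : algebraicOver (ratr : rat -> R[i]) alpha.
  by rewrite alphaE; exact: (algebraic_id (ratr : {rmorphism rat -> R[i]})).
suff [N digitsN [aN abN]] : exists2 N, min_int_digits alpha N &
    (a%:Z <> b + 1 -> N = a) /\ (a%:Z = b + 1 -> N = (2 * a - 1)%N).
  split=> [/aN <-|/abN <-|]; try exact: calF_min_int_digits.
  by have [S [minS _ S0 SZ]] := digitsN; exists S.
have [bneg|[ab|ba]] : b < 0 \/ a%:Z = b + 1 \/ 0 < b /\ b + 1 < a%:Z by lia.
- by exists a; [apply: (min_int_digits_neg alpha_b)|]; lia.
- exists (2 * a - 1)%N; last by [].
  by apply: (min_int_digits_succ alpha_b) => //; lia.
- by exists a; [apply: (min_int_digits_pos alpha_b)|]; lia.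
Qed.
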